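(* Let $n\ge1$ and define $\varepsilon_n>0$ by $(1+\varepsilon_n)^2=1+8190\,e^{-n/10}$. For every $f(t)=\sum_{j=1}^na_je^{i\lambda_jt}$ with $a_j\in\mathbb{C}$ and real $\lambda_1<\cdots<\lambda_n$, $$|f'(0)| \le (1+\varepsilon_n)\left(27n^5+\sum_{k=1}^n\lambda_k^2\right)^{1/2}\|f\|_{[0,1]}$$ and $$\|f'\|_{[0,1]} \le (1+\varepsilon_n)\left(108n^5+\sum_{k=1}^n\lambda_k^2\right)^{1/2}\|f\|_{[0,1]}.$$
   Context: $\|g\|_{[0,1]}:=\sup_{t\in[0,1]}|g(t)|$. *)

(* Defs.v *)
(* classical reals. Complex numbers are represented by
   their real and imaginary parts. *)
From Stdlib Require Import Reals.
Open Scope R_scope.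

Fixpoint rsum (n : nat) (g : nat -> R) : R :=
  match n with
  | O => 0
  | S m => rsum m g + g m
  end.

(* f(t) = sum_{j<n} (ar j + i ai j) * exp(i lam j t); real and imaginary parts *)
Definition exp_sum_re (n : nat) (ar ai lam : nat -> R) (t : R) : R :=
  rsum n (fun j => ar j * cos (lam j * t) - ai j * sin (lam j * t)).
Definition exp_sum_im (n : nat) (ar ai lam : nat -> R) (t : R) : R :=
  rsum n (fun j => ar j * sin (lam j * t) + ai j * cos (lam j * t)).

Definition exp_sum_abs (n : nat) (ar ai lam : nat -> R) (t : R) : R :=
  sqrt (exp_sum_re n ar ai lam t ^ 2 + exp_sum_im n ar ai lam t ^ 2).

(* f'(t) = sum_j (i lam_j a_j) exp(i lam_j t); i lam_j (ar + i ai) = -lam ai + i lam ar *)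
Definition deriv_re (lam ai : nat -> R) : nat -> R := fun j => - (lam j * ai j).
Definition deriv_im (lam ar : nat -> R) : nat -> R := fun j => lam j * ar j.
Definition exp_sum_deriv_abs (n : nat) (ar ai lam : nat -> R) (t : R) : R :=
  exp_sum_abs n (deriv_re lam ai) (deriv_im lam ar) lam t.

(* s is the sup norm ||g||_[0,1] = sup_{t in [0,1]} g t  (g already nonnegative) *)
Definition is_supnorm01 (g : R -> R) (s : R) : Prop :=
  is_lub (fun y => exists t, 0 <= t <= 1 /\ y = g t) s.

Definition one_plus_eps (n : nat) : R := sqrt (1 + 8190 * exp (- INR n / 10)).

(* Main.v *)
(** Remove the frequencies one at a time.  Put [f_0 = f] and let [f_(k+1)] be
    obtained from [f_k] by multiplying the coefficient of [exp (i lam_j t)] by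
    [i w / (i w - c)], [w = lam_j - lam_k]; the frequency [lam_k] disappears,
    so [f_n = 0], and [f_k' - f_(k+1)' = i lam_k (f_k - f_(k+1)) - c f_(k+1)].
    (The [f_k - f_(k+1)] are, up to normalisation, the components of [f] in the
    Malmquist-Takenaka basis of [L^2(exp (- c t) dt)] on the half line.)
    Consequently [f'] is the sum of [(i lam_k - c k) (f_k - f_(k+1))], and
    Cauchy-Schwarz bounds [|f'(0)|] by the energy [E = sum |f_k - f_(k+1)|^2]
    at time 0.  Since [(exp (- c t) E)' = - c exp (- c t) |f|^2], that energy is at most
    [||f||^2 + exp (- c) E(1)].  The same computation with the weights [49^k] gives
    exponential decay of [exp (- c t) E], hence, for [c = 9 n], the term
    [exp (- c) E(1)] is at most [exp (- n) E(0)].  The bound at an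
    arbitrary point follows by rescaling the half of [[0,1]] that starts or ends at it. *)
Require Import Defs.
From Stdlib Require Import Reals Lra Lia.
Open Scope R_scope.

(** * Finite sums and the complex Cauchy-Schwarz inequality *)

Lemma rsum_ext (n : nat) (g h : nat -> R) :
  (forall k, (k < n)%nat -> g k = h k) -> rsum n g = rsum n h.
Proof.
  induction n as [|n IH]; intros H; simpl; [reflexivity|].
  rewrite IH, H by (intros; try apply H; lia). reflexivity.
Qed.

Lemma rsum_zero (n : nat) : rsum n (fun _ => 0) = 0.
Proof. induction n as [|n IH]; simpl; lra. Qed.

Lemma rsum_plus (n : nat) (g h : nat -> R) :
  rsum n (fun k => g k + h k) = rsum n g + rsum n h.
Proof. induction n as [|n IH]; simpl; [|rewrite IH]; lra. Qed.

Lemma rsum_scal (n : nat) (c : R) (g : nat -> R) :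
  rsum n (fun k => c * g k) = c * rsum n g.
Proof. induction n as [|n IH]; simpl; [|rewrite IH]; lra. Qed.

Lemma rsum_le (n : nat) (g h : nat -> R) :
  (forall k, (k < n)%nat -> g k <= h k) -> rsum n g <= rsum n h.
Proof.
  induction n as [|n IH]; intros H; simpl; [lra|].
  apply Rplus_le_compat; [apply IH; intros|]; apply H; lia.
Qed.

Lemma rsum_nonneg (n : nat) (g : nat -> R) : (forall k, 0 <= g k) -> 0 <= rsum n g.
Proof.
  intros H; rewrite <- (rsum_zero n); apply rsum_le; intros; apply H.
Qed.

Lemma rsum_derivable (n : nat) (g dg : nat -> R -> R) (t : R) :
  (forall k, derivable_pt_lim (g k) t (dg k t)) ->
  derivable_pt_lim (fun u => rsum n (fun k => g k u)) t (rsum n (fun k => dg k t)).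
Proof.
  intros H; induction n as [|n IH]; simpl.
  - apply derivable_pt_lim_const.
  - apply (derivable_pt_lim_plus (fun u => rsum n (fun k => g k u)) (g n)); auto.
Qed.

Lemma rsum_squares_le (n : nat) : rsum n (fun k => INR k ^ 2) <= INR n ^ 3 / 3.
Proof.
  induction n as [|n IH]; cbn [rsum]; [simpl; lra|].
  rewrite S_INR; pose proof (pos_INR n).
  replace ((INR n + 1) ^ 3 / 3) with (INR n ^ 3 / 3 + INR n ^ 2 + INR n + 1 / 3) by field.
  lra.
Qed.

(** Multiplied by [z > 0], the difference of the two sides is at least [(z q - s)^2]; if [z = 0],
    then [s = 0]. *)
Lemma two_mul_le_of_sq_le (s z d q : R) :
  0 <= z -> 0 <= d -> s ^ 2 <= z * d -> 2 * s * q <= z * q ^ 2 + d.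
Proof.
  intros Hz Hd Hs.
  destruct (Rle_lt_or_eq_dec 0 z Hz) as [Hz'|<-].
  - apply Rmult_le_reg_l with z; [exact Hz'|].
    pose proof (pow2_ge_0 (z * q - s)); nra.
  - assert (s = 0) by nra. subst s; nra.
Qed.

(** Induction on [n]: after expansion, the only term without a direct match is the cross term
    [2 (U X + V Y)], which the two mixed products on the right absorb. *)
Lemma rsum_complex_cauchy_schwarz (n : nat) (p q x y : nat -> R) :
  rsum n (fun k => p k * x k - q k * y k) ^ 2 + rsum n (fun k => p k * y k + q k * x k) ^ 2
  <= rsum n (fun k => p k ^ 2 + q k ^ 2) * rsum n (fun k => x k ^ 2 + y k ^ 2).
Proof.
  induction n as [|n IH]; cbn [rsum]; [lra|].
  assert (HZ : 0 <= rsum n (fun k => p k ^ 2 + q k ^ 2))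
    by (apply rsum_nonneg; intros; nra).
  assert (HD : 0 <= rsum n (fun k => x k ^ 2 + y k ^ 2))
    by (apply rsum_nonneg; intros; nra).
  set (A := rsum n (fun k => p k * x k - q k * y k)) in *.
  set (B := rsum n (fun k => p k * y k + q k * x k)) in *.
  set (Z := rsum n (fun k => p k ^ 2 + q k ^ 2)) in *.
  set (D := rsum n (fun k => x k ^ 2 + y k ^ 2)) in *.
  generalize (p n) (q n) (x n) (y n); intros P Q X Y.
  (* [(U, V)] is [(A + i B)] times the conjugate of [P + i Q]. *)
  set (U := A * P + B * Q). set (V := B * P - A * Q).
  assert (HUV : U ^ 2 + V ^ 2 <= Z * (D * (P ^ 2 + Q ^ 2))).
  { replace (U ^ 2 + V ^ 2) with ((A ^ 2 + B ^ 2) * (P ^ 2 + Q ^ 2)) by (unfold U, V; ring).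
    rewrite <- Rmult_assoc. apply Rmult_le_compat_r; nra. }
  assert (Hc : 2 * (U * X + V * Y) <= Z * (X ^ 2 + Y ^ 2) + D * (P ^ 2 + Q ^ 2)).
  { assert (Hs : (U * X + V * Y) ^ 2
                 <= (Z * (X ^ 2 + Y ^ 2)) * (D * (P ^ 2 + Q ^ 2))).
    { apply Rle_trans with ((U ^ 2 + V ^ 2) * (X ^ 2 + Y ^ 2)).
      (* Lagrange's identity: [(U X + V Y)^2 + (U Y - V X)^2 = (U^2 + V^2) (X^2 + Y^2)]. *)
      - pose proof (pow2_ge_0 (U * Y - V * X)); nra.
      - replace (Z * (X ^ 2 + Y ^ 2) * (D * (P ^ 2 + Q ^ 2)))
          with (Z * (D * (P ^ 2 + Q ^ 2)) * (X ^ 2 + Y ^ 2)) by ring.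
        apply Rmult_le_compat_r; nra. }
    pose proof (two_mul_le_of_sq_le _ (Z * (X ^ 2 + Y ^ 2)) (D * (P ^ 2 + Q ^ 2)) 1
                  ltac:(apply Rmult_le_pos; nra) ltac:(apply Rmult_le_pos; nra) Hs).
    lra. }
  unfold U, V in Hc. nra.
Qed.

(** * Monotonicity, and derivatives of exponential sums *)

Lemma le_of_deriv_nonneg (g dg : R -> R) (u v : R) :
  u < v -> (forall t, derivable_pt_lim g t (dg t)) ->
  (forall t, u <= t <= v -> 0 <= dg t) -> g u <= g v.
Proof.
  intros Huv Hd Hp.
  destruct (MVT_cor2 g dg u v Huv (fun t _ => Hd t)) as [t [Ht Hin]].
  assert (0 <= dg t) by (apply Hp; lra). nra.
Qed.

Lemma exp_le_compat (u v : R) : u <= v -> exp u <= exp v.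
Proof.
  intros [H| ->]; [left; apply exp_increasing; exact H|right; reflexivity].
Qed.

Lemma exp_scal_derivable (k t : R) :
  derivable_pt_lim (fun u => exp (k * u)) t (k * exp (k * t)).
Proof.
  replace (k * exp (k * t)) with (exp (k * t) * (k * 1)) by ring.
  apply (derivable_pt_lim_comp (fun u => k * u) exp).
  - apply (derivable_pt_lim_scal id); apply derivable_pt_lim_id.
  - apply derivable_pt_lim_exp.
Qed.

Lemma exp_mul_derivable (k : R) (g : R -> R) (t l : R) :
  derivable_pt_lim g t l ->
  derivable_pt_lim (fun u => exp (k * u) * g u) t (exp (k * t) * (k * g t + l)).
Proof.
  intros H.
  replace (exp (k * t) * (k * g t + l))
    with (k * exp (k * t) * g t + exp (k * t) * l) by ring.
  apply (derivable_pt_lim_mult (fun u => exp (k * u)) g); auto using exp_scal_derivable.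
Qed.

Lemma exp_sum_re_derivable (n : nat) (ar ai lam : nat -> R) (t : R) :
  derivable_pt_lim (exp_sum_re n ar ai lam) t
    (exp_sum_re n (deriv_re lam ai) (deriv_im lam ar) lam t).
Proof.
  apply (rsum_derivable n (fun j u => ar j * cos (lam j * u) - ai j * sin (lam j * u))
    (fun j u => deriv_re lam ai j * cos (lam j * u) - deriv_im lam ar j * sin (lam j * u))).
  intros j; unfold deriv_re, deriv_im.
  assert (Hl : derivable_pt_lim (fun u => lam j * u) t (lam j * 1))
    by (apply (derivable_pt_lim_scal id); apply derivable_pt_lim_id).
  replace (- (lam j * ai j) * cos (lam j * t) - lam j * ar j * sin (lam j * t))
    with (ar j * (- sin (lam j * t) * (lam j * 1)) - ai j * (cos (lam j * t) * (lam j * 1)))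
    by ring.
  apply (derivable_pt_lim_minus (fun u => ar j * cos (lam j * u))
           (fun u => ai j * sin (lam j * u))).
  - apply (derivable_pt_lim_scal (fun u => cos (lam j * u))).
    apply (derivable_pt_lim_comp (fun u => lam j * u) cos); auto using derivable_pt_lim_cos.
  - apply (derivable_pt_lim_scal (fun u => sin (lam j * u))).
    apply (derivable_pt_lim_comp (fun u => lam j * u) sin); auto using derivable_pt_lim_sin.
Qed.

(* The imaginary part of [f] is the real part of [- i f]. *)
Lemma exp_sum_im_as_re (n : nat) (ar ai lam : nat -> R) (t : R) :
  exp_sum_im n ar ai lam t = exp_sum_re n ai (fun j => - ar j) lam t.
Proof. apply rsum_ext; intros; ring. Qed.

Lemma exp_sum_im_derivable (n : nat) (ar ai lam : nat -> R) (t : R) :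
  derivable_pt_lim (exp_sum_im n ar ai lam) t
    (exp_sum_im n (deriv_re lam ai) (deriv_im lam ar) lam t).
Proof.
  rewrite exp_sum_im_as_re.
  replace (exp_sum_re n (deriv_im lam ar) (fun j => - deriv_re lam ai j) lam t)
    with (exp_sum_re n (deriv_re lam (fun j => - ar j)) (deriv_im lam ai) lam t)
    by (apply rsum_ext; intros; unfold deriv_re, deriv_im; ring).
  apply derivable_pt_lim_ext with (exp_sum_re n ai (fun j => - ar j) lam).
  - intros u; symmetry; apply exp_sum_im_as_re.
  - apply exp_sum_re_derivable.
Qed.

(** * Chains of exponential sums *)

(* [x k + i y k] plays the role of [f_k], with derivative [dx k + i dy k]. *)
Record chain (n : nat) (c : R) (lam : nat -> R) (x y dx dy : nat -> R -> R) : Prop := {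
  chain_dx : forall k t, derivable_pt_lim (x k) t (dx k t);
  chain_dy : forall k t, derivable_pt_lim (y k) t (dy k t);
  chain_re : forall k t,
    dx k t - dx (S k) t = - lam k * (y k t - y (S k) t) - c * x (S k) t;
  chain_im : forall k t,
    dy k t - dy (S k) t = lam k * (x k t - x (S k) t) - c * y (S k) t;
  chain_x_end : forall t, x n t = 0;
  chain_y_end : forall t, y n t = 0;
  chain_dx_end : forall t, dx n t = 0;
  chain_dy_end : forall t, dy n t = 0
}.

(** With a real denominator, the multiplier [i w / (i w - c)] reads
    [(w^2 - i c w) / (w^2 + c^2)]. *)
Fixpoint chain_coef (c : R) (ar ai lam : nat -> R) (k j : nat) : R * R :=
  match k with
  | O => (ar j, ai j)
  | S k' =>
      let w := lam j - lam k' in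
      let z := chain_coef c ar ai lam k' j in
      ((w ^ 2 * fst z + c * w * snd z) / (w ^ 2 + c ^ 2),
       (w ^ 2 * snd z - c * w * fst z) / (w ^ 2 + c ^ 2))
  end.

(** Passing from [j] to [S j] multiplies by a factor with [w = 0]; later factors keep the
    coefficient zero. *)
Lemma chain_coef_vanish (c : R) (ar ai lam : nat -> R) (k j : nat) :
  (j < k)%nat -> chain_coef c ar ai lam k j = (0, 0).
Proof.
  induction k as [|k IH]; intros Hj; [lia|]; simpl chain_coef.
  destruct (Nat.eq_dec j k) as [->|Hne].
  - f_equal; unfold Rdiv; ring.
  - rewrite IH by lia; simpl; f_equal; unfold Rdiv; ring.
Qed.

(** The definition gives [(i w - c) z' = i w z], that is [i w (z - z') = - c z']; these are its real
    and imaginary parts with [w = lam j - lam k]. *)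
Lemma chain_coef_step (c : R) (ar ai lam : nat -> R) (k j : nat) :
  0 < c ->
  let z := chain_coef c ar ai lam k j in
  let z' := chain_coef c ar ai lam (S k) j in
  - lam j * (snd z - snd z') = - lam k * (snd z - snd z') - c * fst z' /\
  lam j * (fst z - fst z') = lam k * (fst z - fst z') - c * snd z'.
Proof.
  intros Hc; simpl.
  assert (Hpos : (lam j - lam k) ^ 2 + c ^ 2 <> 0).
  { pose proof (pow2_ge_0 (lam j - lam k)); pose proof (pow_lt c 2 Hc); lra. }
  split; field; nra.
Qed.

Lemma exp_sum_chain (n : nat) (c : R) (ar ai lam : nat -> R) :
  0 < c ->
  let br k j := fst (chain_coef c ar ai lam k j) in
  let bi k j := snd (chain_coef c ar ai lam k j) in
  chain n c lam
    (fun k => exp_sum_re n (br k) (bi k) lam)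
    (fun k => exp_sum_im n (br k) (bi k) lam)
    (fun k => exp_sum_re n (deriv_re lam (bi k)) (deriv_im lam (br k)) lam)
    (fun k => exp_sum_im n (deriv_re lam (bi k)) (deriv_im lam (br k)) lam).
Proof.
  intros Hc br bi.
  assert (Hvan : forall j, (j < n)%nat -> br n j = 0 /\ bi n j = 0)
    by (intros; unfold br, bi; rewrite chain_coef_vanish by assumption; auto).
  assert (Hstep : forall k j,
    - lam j * (bi k j - bi (S k) j) = - lam k * (bi k j - bi (S k) j) - c * br (S k) j /\
    lam j * (br k j - br (S k) j) = lam k * (br k j - br (S k) j) - c * bi (S k) j)
    by (intros; apply chain_coef_step; exact Hc).
  clearbody br bi.
  (* Transfers a linear relation between coefficients to the sums. *)
  assert (Hcomb : forall (p q r s : nat -> R) (A B : R),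
    (forall j, (j < n)%nat -> p j - q j = A * r j - B * s j) ->
    rsum n p - rsum n q = A * rsum n r - B * rsum n s).
  { intros p q r s A B H.
    cut (rsum n p = rsum n q + (A * rsum n r + (- B) * rsum n s)); [lra|].
    rewrite <- !rsum_scal, <- !rsum_plus. apply rsum_ext.
    intros j Hj; specialize (H j Hj); lra. }
  constructor.
  - intros; apply exp_sum_re_derivable.
  - intros; apply exp_sum_im_derivable.
  - intros k t. unfold exp_sum_re, exp_sum_im, deriv_re, deriv_im.
    replace (rsum n (fun j => br k j * sin (lam j * t) + bi k j * cos (lam j * t))
      - rsum n (fun j => br (S k) j * sin (lam j * t) + bi (S k) j * cos (lam j * t)))
      with (rsum n (fun j => (br k j - br (S k) j) * sin (lam j * t)
                             + (bi k j - bi (S k) j) * cos (lam j * t))).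
    + apply Hcomb; intros j Hj.
      destruct (Hstep k j) as [H1 H2].
      replace (- (lam j * bi k j) * cos (lam j * t) - lam j * br k j * sin (lam j * t) -
        (- (lam j * bi (S k) j) * cos (lam j * t) - lam j * br (S k) j * sin (lam j * t)))
        with ((- lam j * (bi k j - bi (S k) j)) * cos (lam j * t)
              - (lam j * (br k j - br (S k) j)) * sin (lam j * t)) by ring.
      rewrite H1, H2; ring.
    (* Splitting the sum of differences is [Hcomb] with [q = 0] and [A = B = 1]; the rewrites only
       bring the goal to that shape. *)
    + rewrite <- (Rmult_1_l (rsum n (fun j => br k j * _ + _))),
        <- (Rmult_1_l (rsum n (fun j => br (S k) j * _ + _))).
      symmetry; rewrite <- (Rminus_0_r (rsum n (fun j => (_ - _) * _ + _))).
      rewrite <- (rsum_zero n); symmetry; apply Hcomb; intros; ring.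
  - intros k t. unfold exp_sum_re, exp_sum_im, deriv_re, deriv_im.
    replace (rsum n (fun j => br k j * cos (lam j * t) - bi k j * sin (lam j * t))
      - rsum n (fun j => br (S k) j * cos (lam j * t) - bi (S k) j * sin (lam j * t)))
      with (rsum n (fun j => (br k j - br (S k) j) * cos (lam j * t)
                             - (bi k j - bi (S k) j) * sin (lam j * t))).
    + apply Hcomb; intros j Hj.
      destruct (Hstep k j) as [H1 H2].
      replace (- (lam j * bi k j) * sin (lam j * t) + lam j * br k j * cos (lam j * t) -
        (- (lam j * bi (S k) j) * sin (lam j * t) + lam j * br (S k) j * cos (lam j * t)))
        with ((- lam j * (bi k j - bi (S k) j)) * sin (lam j * t)
              + (lam j * (br k j - br (S k) j)) * cos (lam j * t)) by ring.
      rewrite H1, H2; ring.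
    + rewrite <- (Rmult_1_l (rsum n (fun j => br k j * _ - _))),
        <- (Rmult_1_l (rsum n (fun j => br (S k) j * _ - _))).
      symmetry; rewrite <- (Rminus_0_r (rsum n (fun j => (_ - _) * _ - _))).
      rewrite <- (rsum_zero n); symmetry; apply Hcomb; intros; ring.
  - intros t; unfold exp_sum_re; rewrite <- (rsum_zero n); apply rsum_ext; intros j Hj.
    destruct (Hvan j Hj) as [-> ->]; ring.
  - intros t; unfold exp_sum_im; rewrite <- (rsum_zero n); apply rsum_ext; intros j Hj.
    destruct (Hvan j Hj) as [-> ->]; ring.
  - intros t; unfold exp_sum_re, deriv_re, deriv_im; rewrite <- (rsum_zero n).
    apply rsum_ext; intros j Hj. destruct (Hvan j Hj) as [-> ->]; ring.
  - intros t; unfold exp_sum_im, deriv_re, deriv_im; rewrite <- (rsum_zero n).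
    apply rsum_ext; intros j Hj. destruct (Hvan j Hj) as [-> ->]; ring.
Qed.

(** * Energy estimates *)

Definition normsq (x y : nat -> R -> R) (k : nat) (t : R) : R := x k t ^ 2 + y k t ^ 2.

Definition gap (x y : nat -> R -> R) (k : nat) (t : R) : R :=
  (x k t - x (S k) t) ^ 2 + (y k t - y (S k) t) ^ 2.

Lemma gap_nonneg (x y : nat -> R -> R) (k : nat) (t : R) : 0 <= gap x y k t.
Proof. apply Rplus_le_le_0_compat; apply pow2_ge_0. Qed.

(** Used with [rho = 1], where its derivative telescopes, and with [rho = 49], where its growth is
    controlled without any bound on [f]. *)
Definition energy (n : nat) (rho : R) (x y : nat -> R -> R) (t : R) : R :=
  rsum n (fun k => rho ^ k * gap x y k t).

Lemma energy_nonneg (n : nat) (rho : R) (x y : nat -> R -> R) (t : R) :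
  0 <= rho -> 0 <= energy n rho x y t.
Proof.
  intros Hr; apply rsum_nonneg; intros k; apply Rmult_le_pos; [apply pow_le; lra|].
  apply gap_nonneg.
Qed.

Lemma energy_one_le (n : nat) (rho : R) (x y : nat -> R -> R) (t : R) :
  1 <= rho -> energy n 1 x y t <= energy n rho x y t.
Proof.
  intros Hr; apply rsum_le; intros k _.
  apply Rmult_le_compat_r; [apply gap_nonneg|].
  rewrite pow1; apply pow_R1_Rle; exact Hr.
Qed.

Lemma energy_le_one (n : nat) (rho : R) (x y : nat -> R -> R) (t : R) :
  1 <= rho -> energy n rho x y t <= rho ^ n * energy n 1 x y t.
Proof.
  intros Hr; unfold energy; rewrite <- rsum_scal; apply rsum_le; intros k Hk.
  rewrite pow1, Rmult_1_l.
  apply Rmult_le_compat_r; [apply gap_nonneg|].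
  apply Rle_pow; [exact Hr|lia].
Qed.

(** For [d = f_k - f_(k+1)] the chain relation is [d' = i lam_k d - c f_(k+1)]. The rotation does
    not change [|d|], so [(|d|^2)'] is [- 2 c] times the inner product of [d] and [f_(k+1)], which
    polarization turns into squared norms. *)
Lemma gap_derivable n c lam x y dx dy (k : nat) (t : R) :
  chain n c lam x y dx dy ->
  derivable_pt_lim (gap x y k) t
    (c * (gap x y k t - normsq x y k t + normsq x y (S k) t)).
Proof.
  intros H.
  assert (Hsq : forall (g : R -> R) l, derivable_pt_lim g t l ->
                derivable_pt_lim (fun u => g u ^ 2) t (2 * g t * l)).
  { intros g l Hg.
    apply derivable_pt_lim_ext with (fun u => g u * g u); [intros; ring|].
    replace (2 * g t * l) with (l * g t + g t * l) by ring.
    apply (derivable_pt_lim_mult g g); exact Hg. }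
  replace (c * (gap x y k t - normsq x y k t + normsq x y (S k) t))
    with (2 * (x k t - x (S k) t) * (dx k t - dx (S k) t)
          + 2 * (y k t - y (S k) t) * (dy k t - dy (S k) t)).
  - apply (derivable_pt_lim_plus (fun u => (x k u - x (S k) u) ^ 2)
             (fun u => (y k u - y (S k) u) ^ 2)).
    + apply (Hsq (fun u => x k u - x (S k) u)).
      apply (derivable_pt_lim_minus (x k) (x (S k))); apply (chain_dx _ _ _ _ _ _ _ H).
    + apply (Hsq (fun u => y k u - y (S k) u)).
      apply (derivable_pt_lim_minus (y k) (y (S k))); apply (chain_dy _ _ _ _ _ _ _ H).
  - rewrite (chain_re _ _ _ _ _ _ _ H), (chain_im _ _ _ _ _ _ _ H).
    unfold gap, normsq; ring.
Qed.

Lemma energy_derivable n c lam x y dx dy (rho t : R) :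
  chain n c lam x y dx dy ->
  derivable_pt_lim (energy n rho x y) t
    (c * energy n rho x y t
     - c * rsum n (fun k => rho ^ k * (normsq x y k t - normsq x y (S k) t))).
Proof.
  intros H.
  replace (c * energy n rho x y t
     - c * rsum n (fun k => rho ^ k * (normsq x y k t - normsq x y (S k) t)))
    with (rsum n (fun k => rho ^ k *
            (c * (gap x y k t - normsq x y k t + normsq x y (S k) t)))).
  - apply (rsum_derivable n (fun k u => rho ^ k * gap x y k u)
      (fun k u => rho ^ k * (c * (gap x y k u - normsq x y k u + normsq x y (S k) u)))).
    intros k; apply (derivable_pt_lim_scal (gap x y k)).
    apply gap_derivable with (1 := H).
  - unfold energy.
    cut (forall m, rsum m (fun k => rho ^ k *
            (c * (gap x y k t - normsq x y k t + normsq x y (S k) t)))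
       = c * rsum m (fun k => rho ^ k * gap x y k t)
         - c * rsum m (fun k => rho ^ k * (normsq x y k t - normsq x y (S k) t)));
      [intros E; apply E|].
    induction m as [|m IH]; cbn [rsum]; [|rewrite IH]; ring.
Qed.

Lemma rsum_telescope (n : nat) (g : nat -> R) :
  rsum n (fun k => 1 ^ k * (g k - g (S k))) = g O - g n.
Proof.
  induction n as [|n IH]; cbn [rsum]; [|rewrite IH, pow1]; ring.
Qed.

(** The derivative of [exp (- c t) (E - M^2)] is [c exp (- c t) (M^2 - |f|^2)], nonnegative on
    [[0,1]]. Comparing the endpoints and dropping [- exp (- c) M^2] gives the bound. *)
Lemma energy_initial_le n c lam x y dx dy (M : R) :
  0 <= c -> chain n c lam x y dx dy ->
  (forall t, 0 <= t <= 1 -> normsq x y 0 t <= M ^ 2) ->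
  energy n 1 x y 0 <= M ^ 2 + exp (- c) * energy n 1 x y 1.
Proof.
  intros Hc H HM.
  assert (Hmono := le_of_deriv_nonneg
    (fun t => exp (- c * t) * (energy n 1 x y t - M ^ 2))
    (fun t => exp (- c * t) * (- c * (energy n 1 x y t - M ^ 2) +
       (c * energy n 1 x y t - c * normsq x y 0 t - 0))) 0 1 ltac:(lra)).
  cbv beta in Hmono.
  rewrite Rmult_0_r, exp_0, !Rmult_1_r, Rmult_1_l in Hmono.
  pose proof (exp_pos (- c)); pose proof (pow2_ge_0 M).
  enough (energy n 1 x y 0 - M ^ 2 <= exp (- c) * (energy n 1 x y 1 - M ^ 2)) by nra.
  apply Hmono.
  - intros t; apply (exp_mul_derivable (- c) (fun u => energy n 1 x y u - M ^ 2)).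
    apply (derivable_pt_lim_minus (energy n 1 x y) (fun _ => M ^ 2));
      [|apply derivable_pt_lim_const].
    assert (D := energy_derivable _ _ _ _ _ _ _ 1 t H).
    rewrite (rsum_telescope n (fun k => normsq x y k t)) in D.
    replace (normsq x y n t) with 0 in D; [rewrite Rminus_0_r in D; exact D|].
    unfold normsq; rewrite (chain_x_end _ _ _ _ _ _ _ H), (chain_y_end _ _ _ _ _ _ _ H).
    ring.
  - intros t Ht; apply Rmult_le_pos; [left; apply exp_pos|].
    specialize (HM t Ht); nra.
Qed.

(* [gap k <= 8/7 |f_k|^2 + 8 |f_(k+1)|^2]; the boundary constant [4/21] makes
   the weighted telescoping exact. *)
Lemma energy_le_weighted_norms (n : nat) (x y : nat -> R -> R) (t : R) :
  energy n 49 x y t <=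
    4 / 3 * rsum n (fun k => 49 ^ k * (normsq x y k t - normsq x y (S k) t))
    + 4 / 21 * 49 ^ n * normsq x y n t.
Proof.
  induction n as [|n IH]; unfold energy in *; cbn [rsum].
  - unfold normsq; simpl; nra.
  - rewrite <- tech_pow_Rmult.
    assert (Hg : gap x y n t <= 8 / 7 * normsq x y n t + 8 * normsq x y (S n) t).
    { unfold gap, normsq.
      (* [8/7 a^2 + 8 b^2 - (a - b)^2 = (a + 7 b)^2 / 7]. *)
      pose proof (pow2_ge_0 (x n t + 7 * x (S n) t));
      pose proof (pow2_ge_0 (y n t + 7 * y (S n) t)); nra. }
    pose proof (pow_lt 49 n ltac:(lra)) as Hp.
    apply (Rmult_le_compat_l (49 ^ n)) in Hg; [|lra].
    lra.
Qed.

(** As [f_n = 0], the boundary term of [energy_le_weighted_norms] vanishes and [S0 >= 3/4 E]. Hence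
    [E' = c E - c S0 <= (c / 4) E]. The sign is reversed below so that the monotone quantity
    increases. *)
Lemma energy_decay n c lam x y dx dy :
  0 <= c -> chain n c lam x y dx dy ->
  energy n 49 x y 1 <= exp (c / 4) * energy n 49 x y 0.
Proof.
  intros Hc H.
  set (S0 := fun t => rsum n (fun k => 49 ^ k * (normsq x y k t - normsq x y (S k) t))).
  assert (Hmono := le_of_deriv_nonneg
    (fun t => - (exp (- (c / 4) * t) * energy n 49 x y t))
    (fun t => - (exp (- (c / 4) * t) * (- (c / 4) * energy n 49 x y t +
       (c * energy n 49 x y t - c * S0 t)))) 0 1 ltac:(lra)).
  cbv beta in Hmono.
  rewrite Rmult_0_r, exp_0, Rmult_1_r, Rmult_1_l in Hmono.
  assert (exp (- (c / 4)) * energy n 49 x y 1 <= energy n 49 x y 0).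
  { enough (- energy n 49 x y 0 <= - (exp (- (c / 4)) * energy n 49 x y 1)) by lra.
    apply Hmono.
    - intros t; apply (derivable_pt_lim_opp (fun u => exp (- (c / 4) * u) * energy n 49 x y u)).
      apply (exp_mul_derivable (- (c / 4)) (energy n 49 x y)).
      apply energy_derivable with (1 := H).
    - intros t _.
      assert (HW := energy_le_weighted_norms n x y t).
      replace (normsq x y n t) with 0 in HW
        by (unfold normsq; rewrite (chain_x_end _ _ _ _ _ _ _ H),
              (chain_y_end _ _ _ _ _ _ _ H); ring).
      fold (S0 t) in HW.
      pose proof (exp_pos (- (c / 4) * t)).
      assert (0 <= c * (S0 t - 3 / 4 * energy n 49 x y t)) by (apply Rmult_le_pos; lra).
      nra. }
  apply Rmult_le_reg_l with (exp (- (c / 4))); [apply exp_pos|].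
  rewrite <- Rmult_assoc, <- exp_plus, Rplus_opp_l, exp_0, Rmult_1_l; assumption.
Qed.

(** [exp 1 >= (1 + 1/2)^2 = 9/4], and [(9/4)^5 > 49]. *)
Lemma pow49_le_exp (n : nat) : 49 ^ n <= exp (5 * INR n).
Proof.
  assert (H1 : 9 / 4 <= exp 1).
  { replace 1 with (1 / 2 + 1 / 2) by lra; rewrite exp_plus.
    pose proof (exp_ineq1_le (1 / 2)); nra. }
  assert (H5 : 49 <= exp 5).
  { replace 5 with (1 + (1 + (1 + (1 + 1)))) by lra; rewrite !exp_plus.
    apply Rle_trans with ((9 / 4) ^ 5); [lra|].
    replace (exp 1 * _) with (exp 1 ^ 5) by ring; apply pow_incr; lra. }
  induction n as [|n IH].
  - simpl; rewrite Rmult_0_r, exp_0; lra.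
  - rewrite S_INR, Rmult_plus_distr_l, exp_plus, Rmult_1_r, <- tech_pow_Rmult.
    rewrite (Rmult_comm 49); pose proof (pow_lt 49 n ltac:(lra)); apply Rmult_le_compat; lra.
Qed.

(** The choice [c = 9 n] lets [exp (- c)] beat both the growth [exp (c / 4)] and the loss [49^n]
    from changing weights. Then [E <= M^2 + d E] with [d = exp (- n)], which is solved for [E]. *)
Lemma energy_initial_bound n lam x y dx dy (M : R) :
  (1 <= n)%nat -> chain n (9 * INR n) lam x y dx dy ->
  (forall t, 0 <= t <= 1 -> normsq x y 0 t <= M ^ 2) ->
  energy n 1 x y 0 <= one_plus_eps n ^ 2 * M ^ 2.
Proof.
  intros Hn H HM.
  assert (HN : 1 <= INR n) by (apply (le_INR 1); exact Hn).
  assert (H1 := energy_initial_le n (9 * INR n) _ _ _ _ _ M ltac:(lra) H HM).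
  assert (H2 := energy_decay n (9 * INR n) _ _ _ _ _ ltac:(lra) H).
  assert (H3 := energy_one_le n 49 x y 1 ltac:(lra)).
  assert (H4 := energy_le_one n 49 x y 0 ltac:(lra)).
  assert (H0 := energy_nonneg n 1 x y 0 ltac:(lra)).
  set (E := energy n 1 x y 0) in *.
  set (d := exp (- INR n)).
  assert (Hd0 : 0 < d) by apply exp_pos.
  assert (H5 : exp (- (9 * INR n)) * energy n 1 x y 1 <= d * E).
  { apply Rle_trans with
      (exp (- (9 * INR n)) * (exp (9 * INR n / 4) * (exp (5 * INR n) * E))).
    - apply Rmult_le_compat_l; [left; apply exp_pos|].
      eapply Rle_trans; [exact H3|]. eapply Rle_trans; [exact H2|].
      apply Rmult_le_compat_l; [left; apply exp_pos|].
      eapply Rle_trans; [exact H4|].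
      apply Rmult_le_compat_r; [exact H0|apply pow49_le_exp].
    (* The exponents add up to [- 9 n + 9 n / 4 + 5 n = - 7 n / 4 <= - n]. *)
    - rewrite <- !Rmult_assoc, <- !exp_plus.
      apply Rmult_le_compat_r; [exact H0|].
      apply exp_le_compat; lra. }
  assert (Hd : d <= 1 / 2).
  { unfold d; rewrite exp_Ropp.
    pose proof (exp_ineq1_le (INR n)).
    apply Rle_trans with (/ 2); [apply Rinv_le_contravar; lra|lra]. }
  assert (Heps : one_plus_eps n ^ 2 = 1 + 8190 * exp (- INR n / 10)).
  { unfold one_plus_eps; apply pow2_sqrt.
    pose proof (exp_pos (- INR n / 10)); lra. }
  assert (Hde : d <= exp (- INR n / 10)) by (apply exp_le_compat; lra).
  rewrite Heps.
  pose proof (pow2_ge_0 M).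
  (* [1 / (1 - d) <= 1 + 2 d] because [d <= 1/2]. *)
  apply Rle_trans with ((1 + 2 * d) * M ^ 2); [|nra].
  assert ((1 + 2 * d) * (1 - d) >= 1) by nra.
  nra.
Qed.

(** Summation by parts: adding up the chain relations leaves [- c] times the sum of the [f_(k+1)],
    and each of these is rewritten through the differences [f_k - f_(k+1)]. *)
Lemma chain_deriv_expansion n c lam x y dx dy (t : R) :
  chain n c lam x y dx dy ->
  dx O t = rsum n (fun k => - (c * INR k) * (x k t - x (S k) t) - lam k * (y k t - y (S k) t))
  /\ dy O t = rsum n (fun k => - (c * INR k) * (y k t - y (S k) t) + lam k * (x k t - x (S k) t)).
Proof.
  intros H.
  (* The boundary term after [m] steps is [f_m' - c m f_m], which is zero at [m = n]. *)
  assert (Hm : forall m,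
    dx O t = dx m t - c * INR m * x m t
      + rsum m (fun k => - (c * INR k) * (x k t - x (S k) t) - lam k * (y k t - y (S k) t))
    /\ dy O t = dy m t - c * INR m * y m t
      + rsum m (fun k => - (c * INR k) * (y k t - y (S k) t) + lam k * (x k t - x (S k) t))).
  { induction m as [|m [IHx IHy]]; [simpl; lra|].
    cbn [rsum]; rewrite S_INR.
    pose proof (chain_re _ _ _ _ _ _ _ H m t); pose proof (chain_im _ _ _ _ _ _ _ H m t).
    split; lra. }
  destruct (Hm n) as [Hx Hy].
  rewrite (chain_x_end _ _ _ _ _ _ _ H), (chain_dx_end _ _ _ _ _ _ _ H) in Hx.
  rewrite (chain_y_end _ _ _ _ _ _ _ H), (chain_dy_end _ _ _ _ _ _ _ H) in Hy.
  lra.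
Qed.

(** * The derivative bounds *)

Lemma sqrt_le_of_sq (u v : R) : 0 <= v -> u <= v ^ 2 -> sqrt u <= v.
Proof.
  intros Hv H; rewrite <- (sqrt_pow2 v Hv); apply sqrt_le_1_alt; exact H.
Qed.

Lemma one_plus_eps_nonneg (n : nat) : 0 <= one_plus_eps n.
Proof. apply sqrt_pos. Qed.

Lemma exp_sum_deriv_at_zero (n : nat) (ar ai lam : nat -> R) (M : R) :
  (1 <= n)%nat ->
  (forall t, 0 <= t <= 1 -> exp_sum_abs n ar ai lam t <= M) ->
  exp_sum_deriv_abs n ar ai lam 0 <=
    one_plus_eps n * sqrt (27 * INR n ^ 5 + rsum n (fun k => lam k ^ 2)) * M.
Proof.
  intros Hn HM.
  assert (HN : 1 <= INR n) by (apply (le_INR 1); exact Hn).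
  assert (HM0 : 0 <= M) by (apply Rle_trans with (2 := HM 0 ltac:(lra)); apply sqrt_pos).
  assert (HL : 0 <= rsum n (fun k => lam k ^ 2)) by (apply rsum_nonneg; intros; nra).
  assert (HN5 : 0 <= 27 * INR n ^ 5)
    by (apply Rmult_le_pos; [lra|apply pow_le; lra]).
  assert (H := exp_sum_chain n (9 * INR n) ar ai lam ltac:(lra)); cbv zeta in H.
  match type of H with chain _ _ _ ?x' ?y' _ _ => set (x := x') in H; set (y := y') in H end.
  assert (HE : energy n 1 x y 0 <= one_plus_eps n ^ 2 * M ^ 2).
  { apply energy_initial_bound with (1 := Hn) (2 := H).
    intros t Ht. specialize (HM t Ht).
    (* [f_0] is [f] by computation, since [chain_coef] at [0] returns the given coefficients. *)
    change (normsq x y 0 t)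
      with (exp_sum_re n ar ai lam t ^ 2 + exp_sum_im n ar ai lam t ^ 2).
    unfold exp_sum_abs in HM.
    set (q := exp_sum_re n ar ai lam t ^ 2 + exp_sum_im n ar ai lam t ^ 2) in *.
    assert (Hq : 0 <= q) by (unfold q; nra).
    rewrite <- (pow2_sqrt q Hq); apply pow_incr; split; [apply sqrt_pos|exact HM]. }
  destruct (chain_deriv_expansion _ _ _ _ _ _ _ 0 H) as [Hx Hy].
  assert (HCS := rsum_complex_cauchy_schwarz n (fun k => - (9 * INR n * INR k)) lam
    (fun k => x k 0 - x (S k) 0) (fun k => y k 0 - y (S k) 0)).
  cbv beta in HCS; rewrite <- Hx, <- Hy in HCS.
  (* Origin of the 27: the squares of [9 n k] sum to at most [81 n^2 * n^3 / 3]. *)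
  assert (HZ : rsum n (fun k => (- (9 * INR n * INR k)) ^ 2 + lam k ^ 2)
               <= 27 * INR n ^ 5 + rsum n (fun k => lam k ^ 2)).
  { rewrite rsum_plus.
    rewrite (rsum_ext n _ (fun k => 81 * INR n ^ 2 * INR k ^ 2)) by (intros; ring).
    rewrite rsum_scal.
    assert (81 * INR n ^ 2 * rsum n (fun k => INR k ^ 2)
            <= 81 * INR n ^ 2 * (INR n ^ 3 / 3))
      by (apply Rmult_le_compat_l; [nra|apply rsum_squares_le]).
    replace (27 * INR n ^ 5) with (81 * INR n ^ 2 * (INR n ^ 3 / 3)) by field. lra. }
  apply sqrt_le_of_sq.
  - apply Rmult_le_pos; [|exact HM0].
    apply Rmult_le_pos; [apply one_plus_eps_nonneg|apply sqrt_pos].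
  - replace ((one_plus_eps n * sqrt (27 * INR n ^ 5 + rsum n (fun k => lam k ^ 2)) * M) ^ 2)
      with (sqrt (27 * INR n ^ 5 + rsum n (fun k => lam k ^ 2)) ^ 2
            * (one_plus_eps n ^ 2 * M ^ 2)) by ring.
    rewrite pow2_sqrt by lra.
    eapply Rle_trans; [exact HCS|].
    assert (HE' : rsum n (fun k => (x k 0 - x (S k) 0) ^ 2 + (y k 0 - y (S k) 0) ^ 2)
                  = energy n 1 x y 0)
      by (apply rsum_ext; intros; unfold gap; rewrite pow1; ring).
    rewrite HE'.
    apply Rmult_le_compat; [apply rsum_nonneg; intros; nra| |exact HZ|exact HE].
    apply energy_nonneg; lra.
Qed.

(* [g u = f (t0 + h u)] has coefficients [a_j exp (i lam_j t0)] and frequencies [h lam_j]. *)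
Lemma exp_sum_abs_shift (n : nat) (ar ai lam : nat -> R) (t0 h u : R) :
  exp_sum_abs n (fun j => ar j * cos (lam j * t0) - ai j * sin (lam j * t0))
    (fun j => ar j * sin (lam j * t0) + ai j * cos (lam j * t0)) (fun j => h * lam j) u
  = exp_sum_abs n ar ai lam (t0 + h * u).
Proof.
  unfold exp_sum_abs.
  do 2 f_equal; f_equal; apply rsum_ext; intros j _;
    (replace (lam j * (t0 + h * u)) with (lam j * t0 + h * lam j * u) by ring);
    rewrite cos_plus, sin_plus; ring.
Qed.

(** Chain rule at [u = 0]: [g'(0) = h f'(t0)]. The absolute value allows for negative [h]. *)
Lemma exp_sum_deriv_abs_shift (n : nat) (ar ai lam : nat -> R) (t0 h : R) :
  exp_sum_deriv_abs n (fun j => ar j * cos (lam j * t0) - ai j * sin (lam j * t0))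
    (fun j => ar j * sin (lam j * t0) + ai j * cos (lam j * t0)) (fun j => h * lam j) 0
  = Rabs h * exp_sum_deriv_abs n ar ai lam t0.
Proof.
  unfold exp_sum_deriv_abs, exp_sum_abs.
  rewrite <- (sqrt_Rsqr_abs h), <- sqrt_mult_alt by apply Rle_0_sqr.
  f_equal; unfold Rsqr.
  match goal with |- ?a ^ 2 + ?b ^ 2 = _ * (?p ^ 2 + ?q ^ 2) =>
    assert (Ea : a = h * p); [|assert (Eb : b = h * q); [|rewrite Ea, Eb; ring]]
  end; unfold exp_sum_re, exp_sum_im; rewrite <- rsum_scal; apply rsum_ext; intros j _;
    rewrite Rmult_0_r, cos_0, sin_0; unfold deriv_re, deriv_im; ring.
Qed.

(** Apply the bound at zero to [u -> f (t0 + h u)]. The derivative is halved and the squared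
    frequencies are quartered, and [2 sqrt (27 n^5 + L / 4) = sqrt (108 n^5 + L)]. The sign of [h]
    decides whether [t0] is the left or the right end of the half interval. *)
Lemma exp_sum_deriv_half_interval (n : nat) (ar ai lam : nat -> R) (M t0 h : R) :
  (1 <= n)%nat -> Rabs h = 1 / 2 ->
  (forall u, 0 <= u <= 1 -> exp_sum_abs n ar ai lam (t0 + h * u) <= M) ->
  exp_sum_deriv_abs n ar ai lam t0 <=
    one_plus_eps n * sqrt (108 * INR n ^ 5 + rsum n (fun k => lam k ^ 2)) * M.
Proof.
  intros Hn Hh HM.
  assert (H := exp_sum_deriv_at_zero n
    (fun j => ar j * cos (lam j * t0) - ai j * sin (lam j * t0))
    (fun j => ar j * sin (lam j * t0) + ai j * cos (lam j * t0)) (fun j => h * lam j) M Hn).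
  rewrite exp_sum_deriv_abs_shift, Hh in H.
  assert (Hh2 : h ^ 2 = 1 / 4) by (rewrite <- pow2_abs, Hh; lra).
  assert (Hs : sqrt (108 * INR n ^ 5 + rsum n (fun k => lam k ^ 2))
    = 2 * sqrt (27 * INR n ^ 5 + rsum n (fun k => (h * lam k) ^ 2))).
  { rewrite (rsum_ext n (fun k => (h * lam k) ^ 2) (fun k => h ^ 2 * lam k ^ 2))
      by (intros; ring).
    rewrite rsum_scal, Hh2.
    set (L := rsum n (fun k => lam k ^ 2)).
    replace (108 * INR n ^ 5 + L) with (2 ^ 2 * (27 * INR n ^ 5 + 1 / 4 * L)) by field.
    rewrite sqrt_mult_alt, sqrt_pow2 by lra; reflexivity. }
  rewrite Hs.
  enough (1 / 2 * exp_sum_deriv_abs n ar ai lam t0 <=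
    one_plus_eps n * sqrt (27 * INR n ^ 5 + rsum n (fun k => (h * lam k) ^ 2)) * M) by lra.
  apply H; intros u Hu; rewrite exp_sum_abs_shift; apply HM; exact Hu.
Qed.

Theorem theorem9p1 (n : nat) (hn : (1 <= n)%nat) (ar ai lam : nat -> R)
  (hlam : forall j, (S j < n)%nat -> lam j < lam (S j)) :
  (forall s, is_supnorm01 (exp_sum_abs n ar ai lam) s ->
     exp_sum_deriv_abs n ar ai lam 0 <=
       one_plus_eps n * sqrt (27 * INR n ^ 5 + rsum n (fun k => lam k ^ 2)) * s)
  /\
  (forall s s', is_supnorm01 (exp_sum_abs n ar ai lam) s ->
     is_supnorm01 (exp_sum_deriv_abs n ar ai lam) s' ->
     s' <= one_plus_eps n * sqrt (108 * INR n ^ 5 + rsum n (fun k => lam k ^ 2)) * s).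
Proof.
  assert (Hsup : forall s, is_supnorm01 (exp_sum_abs n ar ai lam) s ->
            forall t, 0 <= t <= 1 -> exp_sum_abs n ar ai lam t <= s)
    by (intros s [Hub _] t Ht; apply Hub; exists t; split; [exact Ht|reflexivity]).
  split.
  - intros s Hs; apply exp_sum_deriv_at_zero; auto.
  - intros s s' Hs [_ Hleast]; apply Hleast; intros v [t0 [Ht0 ->]].
    (* Go forward from [t0] in the left half and backward in the right half, so that the interval of
       length [1/2] stays inside [[0,1]]. *)
    destruct (Rle_dec t0 (1 / 2)) as [Hl|Hl].
    + apply exp_sum_deriv_half_interval with (h := 1 / 2); [exact hn| |].
      * apply Rabs_pos_eq; lra.
      * intros u Hu; apply Hsup; [exact Hs|lra].
    + apply exp_sum_deriv_half_interval with (h := - (1 / 2)); [exact hn| |].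
      * rewrite Rabs_Ropp; apply Rabs_pos_eq; lra.
      * intros u Hu; apply Hsup; [exact Hs|lra].
Qed.
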